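(* Suppose that $X$ is a topological space, $I$ is a set, and $E$ is a subset of $\mathcal{S}(I)$ closed under taking supersets (that is, if $A \in E$ and $A \subseteq B \subseteq I$, then $B \in E$). Then the following conditions are equivalent. (1) Every power of $X$ satisfies the $E$-accumulation property. (2) $X$ satisfies the $F$-accumulation property, for some filter $F \subseteq E$. (3) $X$ satisfies the $F$-accumulation property, for some filter $F$ which is maximal among the filters contained in $E$. (4) $X^\delta$ satisfies the $E$-accumulation property, where $\delta$ is the cardinality of the set of all the filters which are maximal among the filters contained in $E$. (5) $X^\delta$ satisfies the $E$-accumulation property, for $\delta = |X|^{|I|}$.
   Context: $\mathcal{S}(I)$ denotes the set of all subsets of $I$. A filter on a set $I$ is a nonempty proper subset of $\mathcal{S}(I)$ which is closed under finite intersections and under taking supersets; the filters in the statement are filters on $I$. Given a set $I$, a subset $E \subseteq \mathcal{S}(I)$, and an $I$-indexed sequence $(x_i)_{i\in I}$ of elements of a topological space $X$, a point $x \in X$ is an $E$-accumulation point of $(x_i)_{i \in I}$ if and only if for every open neighborhood $U$ of $x$ the set $\{i \in I \mid x_i \in U\}$ belongs to $E$. The space $X$ satisfies the $E$-accumulation property (is $E$-compact) if and only if every $I$-indexed sequence of elements of $X$ has some (not necessarily unique) $E$-accumulation point in $X$. No separation axiom is assumed. Powers of $X$ carry the Tychonoff product topology.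
   Formalization: The set I is assumed nonempty; for I empty, E = {∅} and X a single point, condition (1) holds but there is no filter on I, so (2) and (3) fail. *)

(* Defs.v *)
From mathcomp Require Import all_boot all_classical.
From mathcomp Require Import topology.

Set Implicit Arguments.
Unset Strict Implicit.
Unset Printing Implicit Defensive.

Local Open Scope classical_set_scope.

Definition accumulation_point (I : Type) (E : set_system I)
    (X : topologicalType) (s : I -> X) (x : X) : Prop :=
  forall U : set X, open_nbhs x U -> E [set i | U (s i)].

Definition accumulation_property (I : Type) (E : set_system I)
    (X : topologicalType) : Prop :=
  forall s : I -> X, exists x : X, accumulation_point E s x.

(* Filters are nonempty proper subsets of the powerset of I; for families closed
   under supersets this is setT \in F and set0 \notin F, i.e. [ProperFilter]. *)
Definition filter_in (I : Type) (E F : set_system I) : Prop :=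
  ProperFilter F /\ F `<=` E.

Definition maximal_filter_in (I : Type) (E F : set_system I) : Prop :=
  filter_in E F /\
  forall G : set_system I, filter_in E G -> F `<=` G -> G = F.

(* Main.v *)
Require Import Defs.
From mathcomp Require Import all_boot all_classical.
From mathcomp Require Import topology.

Local Open Scope classical_set_scope.

(** For a filter [F], an [F]-accumulation point of a sequence is the same thing
as a limit along [F], and convergence in a power of [X] is convergence of every
coordinate.  So if every sequence in [X] has an [F]-limit, choosing a limit in
each coordinate gives a limit in any power: [F]-accumulation passes from [X] to
its powers, and from [F] to any larger family.  This yields every power from a
filter contained in [E].

In the other direction, [E] need not be closed under intersections, but a single
[E]-accumulation point [x] of a sequence [s] produces a filter inside [E] as
soon as [E] omits the empty set: the preimages under [s] of the neighborhoods of
[x] form a filter base made of members of [E].  Along the filter it generates, [s] converges to [x].  Apply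
this to a sequence in a power whose coordinates are prescribed sequences of [X]:
all of them acquire an accumulation point along one common filter contained in
[E] ([common_filter_of_accumulation]).
- Prescribing all sequences of [X], indexed by [I -> X], every sequence
  in [X] gets an accumulation point along the common filter.
- When the exponent consists of the maximal filters of [E], suppose that [X]
  fails the [M]-accumulation property for each of them, and prescribe at
  coordinate [M] a sequence without [M]-accumulation point.  By Zorn's lemma
  ([maximal_filter_above]) the common filter extends to some maximal [M], and
  the sequence at that coordinate has an [M]-accumulation point after all. *)

(** * Accumulation points and convergence *)

Lemma accumulation_property_sub (I : Type) (E F : set_system I)
    (X : topologicalType) :
  F `<=` E -> accumulation_property F X -> accumulation_property E X.
Proof.
by move=> FE FX s; have [x xP] := FX s; exists x => U /xP /FE.
Qed.

Lemma accumulation_pointP (I : Type) (E : set_system I) (X : topologicalType)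
    (s : I -> X) (x : X) :
  (forall A B : set I, E A -> A `<=` B -> E B) ->
  accumulation_point E s x <-> (forall U, nbhs x U -> E (s @^-1` U)).
Proof.
move=> E_up; split=> [Esx U|Esx U /open_nbhs_nbhs /Esx //].
by rewrite nbhsE => -[V /Esx EV VU]; apply: E_up EV _ => i /VU.
Qed.

Lemma filter_accumulation_pointP (I : Type) (F : set_system I)
    (X : topologicalType) (s : I -> X) (x : X) :
  Filter F -> accumulation_point F s x <-> s @ F --> x.
Proof.
by move=> FF; apply: accumulation_pointP => A B FA AB; apply: filterS FA.
Qed.

(** The product topology is the coarsest one making the coordinates
continuous: a supremum of initial topologies, in each of which convergence only
tests the corresponding coordinate. *)
Lemma cvg_ptwsP (J : Type) (X : topologicalType)
    (F : set_system {ptws J -> X}) (x : {ptws J -> X}) :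
  Filter F -> F --> x <-> forall j, (fun f : {ptws J -> X} => f j) @ F --> x j.
Proof.
move=> FF; split=> [/cvg_sup Fx j U|Fx].
  by move/initial_continuous/(Fx j).
apply/cvg_sup => j U.
have /= -> := @nbhsE (initial_topology (fun f : J -> X => f j)) x.
move=> [_ [[C oC <-] Cx] CU]; apply: filterS CU _.
by apply: (Fx j C); apply: open_nbhs_nbhs.
Qed.

Lemma filter_accumulation_property_ptws (I J : Type) (F : set_system I)
    (X : topologicalType) :
  Filter F -> accumulation_property F X ->
  accumulation_property F {ptws J -> X}.
Proof.
move=> FF FX s; have [x xP] := choice (fun j => FX (s ^~ j)).
exists x; apply/filter_accumulation_pointP/cvg_ptwsP => j.
exact/(filter_accumulation_pointP _ _ _ (s ^~ j)).
Qed.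

(** * Filters contained in a family closed under supersets *)

(** An improper [E] contains every set, in particular the neighborhood traces
which are empty; the principal filter at a point of [I] then serves instead of
the trace filter, since every sequence converges along it. *)
Lemma common_filter_of_accumulation (I J : Type) (E : set_system I)
    (X : topologicalType) (t : J -> I -> X) :
  [set: I] !=set0 ->
  (forall A B : set I, E A -> A `<=` B -> E B) ->
  accumulation_property E {ptws J -> X} ->
  exists2 F : set_system I, filter_in E F &
    forall j, exists x, accumulation_point F (t j) x.
Proof.
move=> [i0 _] E_up EXJ.
have [E0|nE0] := EM (E set0).
  exists (principal_filter i0).
    by split; [exact: principal_filter_proper | move=> A _; exact: E_up E0 _].
  by move=> j; exists (t j i0) => U [_ Ut]; apply/principal_filterP.
pose s i : {ptws J -> X} := t ^~ i.
have [x /(accumulation_pointP _ _ _ _ _ E_up) Esx] := EXJ s.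
pose F := filter_from (nbhs x) (fun U => s @^-1` U).
have FF : Filter F.
  apply: filter_from_filter; first by exists setT; exact: filterT.
  by move=> U V xU xV; exists (U `&` V) => //; exact: filterI.
exists F.
  split=> [|A [U /Esx EU UA]]; last exact: E_up EU UA.
  apply: filter_from_proper => U /Esx EU.
  by apply/set0P/eqP => U0; apply: nE0; rewrite -U0.
have /cvg_ptwsP Fx : s @ F --> x by move=> U xU; exists U.
by move=> j; exists (x j); apply/filter_accumulation_pointP/(Fx j).
Qed.

Lemma maximal_filter_above (I : Type) (E F : set_system I) :
  filter_in E F -> exists2 M, maximal_filter_in E M & F `<=` M.
Proof.
move=> FE.
(* Comparing the sets [F `|` G] rather than filters above [F] lets the empty
   chain have an upper bound, its union [set0] standing for [F] itself. *)
pose P := [set G : set_system I | filter_in E (F `|` G)].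
have [|M [PM maxM]] := @Zorn_bigcup _ P.
  move=> C CP Ctot; rewrite /P /=; set V := F `|` _.
  have stage A B : V A -> V B ->
      exists G, [/\ P G, F `|` G `<=` V, (F `|` G) A & (F `|` G) B].
    have sub G : C G -> F `|` G `<=` V.
      by move=> CG; apply: setUS => D GD; exists G.
    move=> [FA|[G CG GA]] [FB|[H CH HB]].
    - exists set0; split; [by rewrite /P /= setU0 | | by left | by left].
      by rewrite setU0; left.
    - by exists H; split; [exact: CP | exact: sub | left | right].
    - by exists G; split; [exact: CP | exact: sub | right | left].
    - case: (Ctot G H CG CH) => GH.
      + by exists H; split; [exact: CP | exact: sub | right; exact: GH | right].
      + by exists G; split; [exact: CP | exact: sub | right | right; exact: GH].
  have [FF FsubE] := FE.
  split; first split.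
  - by move=> V0; have [G [[[+ _] _] _ G0 _]] := stage _ _ V0 V0; apply.
  - split; first by left; exact: filterT.
    + move=> A B VA VB; have [G [[GF _] GV GA GB]] := stage _ _ VA VB.
      by apply: GV; exact: filterI GA GB.
    + move=> A B AB VA; have [G [[GF _] GV GA _]] := stage _ _ VA VA.
      by apply: GV; exact: filterS AB GA.
  - by move=> A VA; have [G [[_ GE] _ GA _]] := stage _ _ VA VA; exact: GE.
exists (F `|` M); last by left.
split=> // H HE MH; apply/seteqP; split=> // A HA; right.
have FH : F `|` H = H by apply/setUidPr => B FB; apply: MH; left.
apply: contrapT => nMA; apply: (maxM H); last by rewrite /P /= FH.
by split=> [B MB|HM]; [apply: MH; right | exact/nMA/HM].
Qed.

Lemma filter_of_maximal_power (X : topologicalType) (I : Type)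
    (E : set_system I) :
  [set: I] !=set0 ->
  (forall A B : set I, E A -> A `<=` B -> E B) ->
  accumulation_property E
    {ptws {F : set_system I | maximal_filter_in E F} -> X} ->
  exists2 F : set_system I, filter_in E F & accumulation_property F X.
Proof.
move=> I0 E_up EXm; apply: contrapT => noF.
have bad (M : {F : set_system I | maximal_filter_in E F}) :
    exists s : I -> X, ~ exists x, accumulation_point (sval M) s x.
  case: M => M [ME maxM] /=; apply/existsNP => MX.
  by apply: noF; exists M.
have [t tP] := choice bad.
have [F FE Ft] := common_filter_of_accumulation _ _ _ _ t I0 E_up EXm.
have [M maxM FM] := maximal_filter_above _ _ _ FE.
have [x Fx] := Ft (exist _ M maxM).
by apply: (tP (exist _ M maxM)); exists x => U /Fx /FM.
Qed.

Theorem theorem2p4 (X : topologicalType) (I : Type) (E : set_system I)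
  (I_nonempty : [set: I] !=set0)
  (E_up : forall A B : set I, E A -> A `<=` B -> E B) :
  [<-> forall J : Type, accumulation_property E {ptws J -> X};
       exists2 F : set_system I,
         filter_in E F & accumulation_property F X;
       exists2 F : set_system I,
         maximal_filter_in E F & accumulation_property F X;
       accumulation_property E
         {ptws {F : set_system I | maximal_filter_in E F} -> X};
       accumulation_property E {ptws (I -> X) -> X}].
Proof.
have powers (F : set_system I) (J : Type) : filter_in E F ->
    accumulation_property F X -> accumulation_property E {ptws J -> X}.
  move=> [FF FsubE] FX; apply: accumulation_property_sub FsubE _.
  exact: filter_accumulation_property_ptws.
have of_all_sequences : accumulation_property E {ptws (I -> X) -> X} ->
    exists2 F : set_system I, filter_in E F & accumulation_property F X.
  exact: common_filter_of_accumulation (fun s : I -> X => s) I_nonempty E_up.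
tfae.
- by move=> EX; apply: of_all_sequences; exact: EX.
- move=> [F /maximal_filter_above [M maxM FM] FX]; exists M => //.
  exact: accumulation_property_sub FM FX.
- by move=> [F [FE _] FX]; exact: powers FE FX.
- move=> /(filter_of_maximal_power _ _ _ I_nonempty E_up) [F FE FX].
  exact: powers FE FX.
- by move=> /of_all_sequences [F FE FX] J; exact: powers FE FX.
Qed.
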